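(* Let $s,t\geq 1$ be integers. Every $K_{s,t}$-subgraph-free graph $G$ is $s$-colourable with defect at most $$\mathrm{col}_2(G)+(t-1)\binom{\mathrm{col}_2(G)}{s-1}.$$
   Context: Graphs are finite, simple and undirected. A graph is $K_{s,t}$-subgraph-free if it has no (not necessarily induced) subgraph isomorphic to the complete bipartite graph $K_{s,t}$. An $s$-colouring assigns one of at most $s$ colours to each vertex (not necessarily properly). A monochromatic component is a connected component of the subgraph induced by all vertices of a single colour. A colouring has defect $d$ if every monochromatic component has maximum degree at most $d$. For a graph $G$, a total order $\preceq$ of $V(G)$, and a positive integer $r$, a vertex $w$ is $r$-reachable from a vertex $v$ if there is a path $v=w_0,w_1,\dots,w_{r'}=w$ in $G$ of length $r'$ with $0\leq r'\leq r$ such that $w\preceq v$ and $v\prec w_i$ for all $i\in\{1,\dots,r'-1\}$ (so $v$ is $r$-reachable from itself). The $r$-strong colouring number $\mathrm{col}_r(G)$ is the minimum integer such that there is a total order $\preceq$ of $V(G)$ for which at most $\mathrm{col}_r(G)$ vertices are $r$-reachable from each vertex of $G$. *)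

(* Defs.v *)
From mathcomp Require Import all_boot.

Set Implicit Arguments.
Unset Strict Implicit.
Unset Printing Implicit Defensive.

Record sgraph := SGraph {
  vertex :> finType;
  adj : rel vertex;
  adj_sym : symmetric adj;
  adj_irr : irreflexive adj
}.

Arguments adj {s} x y.

Section Induced.
Variables (G : sgraph) (A : {set G}).

Let induced_adj : rel {x : G | x \in A} := fun x y => adj (val x) (val y).

Lemma induced_sym : symmetric induced_adj.
Proof. by move=> x y; apply: adj_sym. Qed.

Lemma induced_irr : irreflexive induced_adj.
Proof. by move=> x; apply: adj_irr. Qed.

Definition induced : sgraph := SGraph induced_sym induced_irr.

End Induced.

Section CompleteBipartite.
Variables s t : nat.

Let bip_adj : rel ('I_s + 'I_t)%type := fun x y =>
  match x, y with
  | inl _, inr _ | inr _, inl _ => true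
  | _, _ => false
  end.

Lemma bip_sym : symmetric bip_adj.
Proof. by case=> x [] y. Qed.

Lemma bip_irr : irreflexive bip_adj.
Proof. by case. Qed.

Definition complete_bipartite : sgraph := SGraph bip_sym bip_irr.

End CompleteBipartite.

(* The image of [f], with the images of the edges of [H], is the copy of [H];
   non-edges of [H] are unconstrained, as the copy need not be induced. *)
Definition has_subgraph (G H : sgraph) : Prop :=
  exists f : H -> G, injective f /\ forall x y : H, adj x y -> adj (f x) (f y).

Definition biclique_subgraph_free (s t : nat) (G : sgraph) : Prop :=
  ~ has_subgraph G (complete_bipartite s t).

Definition max_degree (G : sgraph) : nat :=
  \max_(x : G) #|[set y : G | adj x y]|.

Definition components (G : sgraph) : {set {set G}} :=
  equivalence_partition (connect (@adj G)) [set: G].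

Definition colour_class (G : sgraph) (s : nat) (c : G -> 'I_s) (i : 'I_s) :
    {set G} :=
  [set x | c x == i].

Definition has_defect (G : sgraph) (s : nat) (c : G -> 'I_s) (d : nat) : Prop :=
  forall (i : 'I_s) (C : {set induced (colour_class c i)}),
    C \in components (induced (colour_class c i)) ->
    max_degree (induced C) <= d.

Definition colourable_with_defect (G : sgraph) (s d : nat) : Prop :=
  exists c : G -> 'I_s, has_defect c d.

Section StrongColouringNumber.
Variable G : sgraph.

(* Orders are sets of pairs rather than [rel G], so that they form a finite
   type and quantifying over them stays boolean. *)
Definition total_order (R : {set G * G}) : bool :=
  [&& [forall x, (x, x) \in R],
      [forall x, forall y, ((x, y) \in R) && ((y, x) \in R) ==> (x == y)],
      [forall x, forall y, forall z,
         ((x, y) \in R) && ((y, z) \in R) ==> ((x, z) \in R)]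
    & [forall x, forall y, ((x, y) \in R) || ((y, x) \in R)]].

(* The path is w_0 = v followed by the tuple p = (w_1, ..., w_n). *)
Definition reachable (R : {set G * G}) (r : nat) (v w : G) : bool :=
  [exists n : 'I_r.+1, exists p : n.-tuple G,
    [&& path adj v p, uniq (v :: p), last v p == w, (w, v) \in R
      & [forall i : 'I_n, (0 < i) ==>
           ((v, nth v (v :: p) i) \in R) && (v != nth v (v :: p) i)]]].

Definition col_at_most (r k : nat) : bool :=
  [exists R : {set G * G}, total_order R &&
    [forall v, #|[set w | reachable R r v w]| <= k]].

Lemma col_at_most_ex (r : nat) : exists k, col_at_most r k.
Proof.
exists #|G|; apply/existsP.
exists [set xy : G * G | enum_rank xy.1 <= enum_rank xy.2].
apply/andP; split; last by apply/forallP => v; apply: max_card.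
apply/and4P; split.
- by apply/forallP => x; rewrite inE.
- apply/forallP => x; apply/forallP => y; rewrite !inE /= -eqn_leq.
  by apply/implyP => /eqP/val_inj/enum_rank_inj ->.
- apply/forallP => x; apply/forallP => y; apply/forallP => z; rewrite !inE /=.
  by apply/implyP => /andP[]; apply: leq_trans.
- by apply/forallP => x; apply/forallP => y; rewrite !inE /= leq_total.
Qed.

Definition col (r : nat) : nat := ex_minn (col_at_most_ex r).

End StrongColouringNumber.

(* Main.v *)
Require Import Defs.
From mathcomp Require Import all_boot.

Set Implicit Arguments.
Unset Strict Implicit.
Unset Printing Implicit Defensive.

(** Fix an order witnessing [col G 2] and colour the vertices greedily along it,
    giving each [w] a colour that avoids those of its [s - 1] smallest
    neighbours preceding it.  If [w] shares its colour with an earlier neighbour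
    [v], then at least [s - 1] neighbours of [w] precede [v]; all of these are
    2-reachable from [v] through [w].  Hence each later neighbour of [v] of the
    same colour is a common neighbour of [v] and of some [(s - 1)]-subset of the
    vertices 2-reachable from [v], and each such subset yields at most [t - 1]
    of them as there is no [K_{s,t}].  The earlier neighbours of [v] are
    1-reachable from [v], so there are at most [col G 2] of them. *)

Lemma greedy_colouring (T : finType) (rank : T -> nat) (B : T -> {set T})
    (s : nat) :
  (forall w u, u \in B w -> rank u < rank w) -> (forall w, #|B w| < s) ->
  exists c : T -> 'I_s, forall w u, u \in B w -> c u != c w.
Proof.
move=> ltB cardB.
have fresh (c : T -> 'I_s) w : exists i, i \notin c @: B w.
  apply/existsP; rewrite -negb_forall; apply/negP => /forallP full.
  have := leq_ltn_trans (leq_imset_card c (B w)) (cardB w).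
  rewrite ltnNge -{1}[s]card_ord subset_leq_card //.
  by apply/subsetP => i _; apply: full.
(* Induction on a bound for the rank: stage [n] recolours all vertices of rank [n] at once, which is
   safe since [B w] only contains vertices of strictly smaller rank. *)
suff [c cP] : exists c : T -> 'I_s,
    forall w u, rank w < (\max_(w : T) rank w).+1 -> u \in B w -> c u != c w.
  by exists c => w u; apply: cP; rewrite ltnS leq_bigmax.
elim: (_.+1) => [|n [c cP]].
  (* Colour 0 exists because [#|B x| < s]; drawing this from [x] also covers an empty [T] with
     [s = 0]. *)
  by exists (fun x => Ordinal (leq_ltn_trans (leq0n _) (cardB x))).
exists (fun x => if rank x == n then xchoose (fresh c x) else c x) => w u.
rewrite ltnS leq_eqVlt => /orP[/eqP rw|rw] uB; have := ltB _ _ uB.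
  rewrite rw eqxx => ltu; rewrite (ltn_eqF ltu).
  apply: contraNneq (xchooseP (fresh c w)) => <-.
  exact: imset_f.
by move=> ltu; rewrite (ltn_eqF rw) (ltn_eqF (ltn_trans ltu rw)) cP.
Qed.

(** All other members of the set lie strictly below its member of largest rank, which has fewer than
    [k] elements of [N] below it. *)
Lemma card_low_rank (T : finType) (rank : T -> nat) (N : {set T}) (k : nat) :
  {in N &, injective rank} ->
  #|[set u in N | #|[set x in N | rank x < rank u]| < k]| <= k.
Proof.
move=> rank_inj; set B := [set u in N | _].
have [->|[u0 u0B]] := set_0Vmem B; first by rewrite cards0.
case: (arg_maxnP rank u0B) => u; rewrite -/(u \in B) => uB umax.
have /setIdP[uN] := uB; apply: leq_trans.
rewrite [X in X <= _](cardsD1 u B) uB add1n ltnS subset_leq_card //.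
apply/subsetP => x; rewrite in_setD1 => /andP[xu xB].
have /setIdP[xN _] := xB.
rewrite inE xN ltn_neqAle (umax x xB : rank x <= rank u) andbT.
by apply: contra_neq xu => /rank_inj ->.
Qed.

(** Irreflexivity makes [A] and [W] disjoint, so enumerating each side gives an injective map. *)
Lemma biclique_has_subgraph (s t : nat) (G : sgraph) (A W : {set G}) :
  s <= #|A| -> t <= #|W| -> {in A & W, forall a w, adj a w} ->
  has_subgraph G (complete_bipartite s t).
Proof.
move=> sA tW AW.
pose f (x : 'I_s + 'I_t) := match x with
  | inl i => enum_val (widen_ord sA i)
  | inr j => enum_val (widen_ord tW j)
  end.
have fA i : f (inl i) \in A by apply: enum_valP.
have fW j : f (inr j) \in W by apply: enum_valP.
have fAW i j : f (inl i) <> f (inr j).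
  by move=> e; have := AW _ _ (fA i) (fW j); rewrite e adj_irr.
exists f; split.
  move=> [i|j] [i'|j'] // e; first 1 last.
  - by case: (fAW _ _ e).
  - by case: (fAW _ _ (esym e)).
  - by move/enum_val_inj: e => [/val_inj ->].
  - by move/enum_val_inj: e => [/val_inj ->].
move=> [i|j] [i'|j'] // _; last rewrite adj_sym.
- exact: AW (fA i) (fW j').
- exact: AW (fA i') (fW j).
Qed.

(** Two nested [val] embed a component into [G], sending neighbours to neighbours of the same
    colour. *)
Lemma has_defect_of_mono_degree (G : sgraph) (s : nat) (c : G -> 'I_s) (d : nat) :
  (forall v, #|[set w | adj v w & c w == c v]| <= d) -> has_defect c d.
Proof.
move=> deg i C _; apply/bigmax_leqP => x _.
apply: leq_trans (deg (val (val x))).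
rewrite -(card_imset _ (inj_comp val_inj val_inj)) subset_leq_card //.
apply/subsetP => _ /imsetP[y + ->]; rewrite !inE /= => ->.
have := valP (val x); have := valP (val y).
by rewrite !inE => /eqP cy /eqP cx; apply/eqP/(etrans cy).
Qed.

Lemma leq_card_bigcup_const (I T : finType) (S : {set I}) (F : I -> {set T})
    (k : nat) :
  (forall i, i \in S -> #|F i| <= k) -> #|\bigcup_(i in S) F i| <= #|S| * k.
Proof.
move=> Fk; rewrite -sum_nat_const.
elim/big_rec2: _ => [|i n A iS IH]; first by rewrite cards0.
apply: leq_trans (leq_card_setU _ _).1 _.
by rewrite leq_add // Fk.
Qed.

Section Reachability.
Variables (G : sgraph) (R : {set G * G}) (r : nat).

Lemma reachable_adj (v u : G) :
  adj v u -> (u, v) \in R -> reachable R r.+1 v u.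
Proof.
move=> vu uv.
have vNu : v != u by apply: contraTneq vu => ->; rewrite adj_irr.
apply/existsP; exists (Ordinal (isT : 1 < r.+2)); apply/existsP; exists [tuple u].
rewrite /= vu inE vNu eqxx uv /=.
by apply/forallP => -[[]].
Qed.

Lemma reachable_adj2 (v w u : G) :
  adj v w -> adj w u -> (v, w) \in R -> (u, v) \in R -> u != v ->
  reachable R r.+2 v u.
Proof.
move=> vw wu vwR uv uNv.
have vNw : v != w by apply: contraTneq vw => ->; rewrite adj_irr.
have wNu : w != u by apply: contraTneq wu => ->; rewrite adj_irr.
apply/existsP; exists (Ordinal (isT : 2 < r.+3)).
apply/existsP; exists [tuple w; u].
rewrite /= vw wu !inE negb_or vNw (eq_sym v u) uNv wNu eqxx uv /=.
(* Index 0 is exempt, so [w] at index 1 is the only internal vertex to check. *)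
by apply/forallP => -[[|[]]] //= _; rewrite vwR vNw.
Qed.

End Reachability.

Lemma total_order_rank (G : sgraph) (R : {set G * G}) :
  total_order R ->
  exists rank : G -> nat,
    injective rank /\ forall x y, ((x, y) \in R) = (rank x <= rank y).
Proof.
case/and4P => /forallP refl /forallP anti /forallP trans /forallP tot.
(* Down-sets grow strictly along the order: [y] lies in its own but not in that of a strictly
   smaller [x]. *)
pose rank y := #|[set x | (x, y) \in R]|.
have antiR x y : (x, y) \in R -> (y, x) \in R -> x = y.
  by move=> xy yx; have /forallP/(_ y) := anti x; rewrite xy yx => /eqP.
have transR x y z : (x, y) \in R -> (y, z) \in R -> (x, z) \in R.
  move=> xy yz; have /forallP/(_ y)/forallP/(_ z) := trans x.
  by rewrite xy yz.
have rank_lt x y : (x, y) \in R -> (y, x) \notin R -> rank x < rank y.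
  move=> xy yx; apply: proper_card; apply/properP; split.
    by apply/subsetP => z; rewrite !inE => /transR; apply.
  by exists y; rewrite inE // refl.
have rankE x y : ((x, y) \in R) = (rank x <= rank y).
  case: (boolP ((x, y) \in R)) => xy; last first.
    have /forallP/(_ y) := tot x; rewrite (negbTE xy) /= => yx.
    by rewrite leqNgt rank_lt.
  have [yx|yx] := boolP ((y, x) \in R); first by rewrite (antiR _ _ xy yx) leqnn.
  by rewrite ltnW // rank_lt.
exists rank; split=> // x y e.
by apply: antiR; rewrite rankE e.
Qed.

Theorem theorem17 (s t : nat) (hs : 1 <= s) (ht : 1 <= t) (G : sgraph)
    (hG : biclique_subgraph_free s t G) :
  colourable_with_defect G s (col G 2 + (t - 1) * 'C(col G 2, s - 1)).
Proof.
rewrite /col; case: ex_minnP => k /existsP[R /andP[totR /forallP colR]] _.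
have [rank [rank_inj rankE]] := total_order_rank totR.
pose N w := [set u | adj u w & rank u < rank w].
pose below w v := [set x in N w | rank x < rank v].
(* The [s - 1] smallest earlier neighbours of [w], or all of them if there are fewer. *)
pose B w := [set u in N w | #|below w u| < s - 1].
have ltB w u : u \in B w -> rank u < rank w.
  by rewrite !inE => /andP[/andP[]].
have cardB w : #|B w| < s.
  rewrite -(subnK hs) addn1 ltnS; apply: card_low_rank.
  exact: in2W rank_inj.
have [c cP] := greedy_colouring ltB cardB.
exists c; apply: has_defect_of_mono_degree => v.
set Q := [set w | reachable R 2 v w].
(* Leaving out [v] gives [v |: A] exactly [s] elements; [W A] is its common neighbourhood, so [t]
   vertices there would form a $K_{s,t}$. *)
pose S := [set A : {set G} | A \subset Q :\ v & #|A| == s - 1].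
pose W (A : {set G}) := [set w | adj v w & A \subset [set a | adj a w]].
have cardQv : #|Q :\ v| <= k := leq_trans (subset_leq_card (subD1set _ _)) (colR v).
have WA A : A \in S -> #|W A| <= t - 1.
  rewrite inE => /andP[AQ /eqP cardA].
  rewrite -ltnS subn1 prednK // ltnNge; apply/negP => tW; apply: hG.
  have vA : v \notin A by apply/negP => /(subsetP AQ); rewrite !inE eqxx.
  apply: (@biclique_has_subgraph _ _ _ (v |: A) (W A)) => //.
    by rewrite cardsU1 vA cardA subn1 add1n prednK.
  move=> a w; rewrite !inE => /orP[/eqP->|aA] /andP[] // _.
  by move=> /subsetP/(_ a aA); rewrite inE.
have cover : [set w | adj v w & c w == c v] \subset
    (Q :\ v) :|: \bigcup_(A in S) W A.
  apply/subsetP => w; rewrite inE => /andP[vw cwv].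
  have wNv : w != v by apply: contraTneq vw => ->; rewrite adj_irr.
  rewrite in_setU; case: (leqP (rank w) (rank v)) => [wv|vltw].
    by rewrite !inE wNv reachable_adj // rankE.
  (* As [w] and [v] share a colour, [v] is not in [B w]; the [s - 1] vertices [q] found below it
     form the required [A]. *)
  apply/orP; right; have /card_geqP[q [uq szq qbelow]] : s - 1 <= #|below w v|.
    have vN : v \in N w by rewrite inE vw.
    rewrite leqNgt; apply/negP => lt_s; have /cP/negP[] : v \in B w.
      by rewrite inE vN.
    by rewrite eq_sym.
  apply/bigcupP; exists [set x in q].
    rewrite inE cardsE (card_uniqP uq) szq eqxx andbT.
    apply/subsetP => x; rewrite inE => /qbelow; rewrite !inE.
    move=> /andP[/andP[xw _] xv].
    have xNv : x != v by apply: contraTneq xv => ->; rewrite ltnn.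
    rewrite xNv (@reachable_adj2 _ _ 0 v w) // ?rankE 1?ltnW //.
    by rewrite adj_sym.
  rewrite inE vw; apply/subsetP => x; rewrite !inE => /qbelow.
  by rewrite !inE => /andP[/andP[]].
apply: leq_trans (subset_leq_card cover) _.
apply: leq_trans (leq_card_setU _ _).1 _; apply: leq_add => //.
apply: leq_trans (leq_card_bigcup_const WA) _.
(* [S] has ['C(#|Q :\ v|, s - 1)] members, and binomials are monotone in the upper argument. *)
by rewrite mulnC leq_mul2l cards_draws leq_bin2l ?orbT.
Qed.
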